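(* Let $K\geq 1$ be real and $k\geq2$ an integer. Let $A\subseteq\mathbb{Z}$ be a finite set with $|A|=n$ and $|A+A|=Kn$. Then $A$ is $F_k$-isomorphic to a set of integers contained in the interval $[1,(16kK)^{12K^2}n]$.
   Context: $A+A=\{a+a':a,a'\in A\}$. If $A,B$ are subsets of abelian groups and $f:A\to B$ is injective, $f$ is an $F_k$-isomorphism (Freiman isomorphism of order $k$) if for all $a_1,\dots,a_k,a_1',\dots,a_k'\in A$ we have $a_1+\dots+a_k=a_1'+\dots+a_k'$ if and only if $f(a_1)+\dots+f(a_k)=f(a_1')+\dots+f(a_k')$. *)

(* Defs.v *)
From HB Require Import structures.
From mathcomp Require Import all_boot all_order all_algebra finmap.
From mathcomp Require Import all_classical all_reals all_analysis.

Set Implicit Arguments.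
Unset Strict Implicit.
Unset Printing Implicit Defensive.

Import Order.TTheory GRing.Theory Num.Theory.

Local Open Scope ring_scope.

Definition sumset (G : zmodType) (A B : {fset G}) : {fset G} :=
  [fset (a + b)%R | a in A, b in B]%fset.

(* A map A -> B is given by a total function f : G -> H; only its values on A
   are constrained. *)
Definition Freiman_iso (k : nat) (G H : zmodType) (A : {pred G}) (B : {pred H})
    (f : G -> H) : Prop :=
  [/\ {homo f : x / x \in A >-> x \in B},
      {in A &, injective f}
    & forall a a' : 'I_k -> G,
        (forall i, a i \in A) -> (forall i, a' i \in A) ->
        (\sum_(i < k) a i = \sum_(i < k) a' i <->
         \sum_(i < k) f (a i) = \sum_(i < k) f (a' i))].

Definition Freiman_isomorphic (k : nat) (G H : zmodType)
    (A : {pred G}) (B : {pred H}) : Prop :=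
  exists2 f : G -> H, Freiman_iso k A B f &
    forall b, b \in B -> exists2 a, a \in A & f a = b.

(* Main.v *)
(* Following Green and Ruzsa ("Sets with small sumset, and rectification"), a set
   [A] of [n] integers in [[0, N]] with [N >= (16kK)^(12K^2) n] can be replaced by
   an isomorphic set of smaller diameter; iterating proves the theorem.

   Reduce modulo [q = kN + 1]. Petridis' inequality gives [A'] in [A] with
   [|A' + A + A| <= K^2 |A'|], so [A + A] is covered, up to less than half of each
   translate of [A'], by fewer than [2K^2] translates [x + A'], [x] in [X].
   Hence [D = A' - A'] satisfies [D + D <= D + X - X], so the sets [D + P_m], with
   [P_m] the box of side [m] spanned by the [x - x0], grow polynomially in [m];
   one of them, [B], is almost invariant under the translations by [D] and by the
   [x - x0], while [2 |B| <= q]. Parseval then yields a frequency [y <> 0] for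
   which [y t / q] is on average close to an integer for these [t], and the
   covering transfers this to all of a translate of [A]. A set whose dilate by
   [y] lies in a short interval modulo [q] is rectified by [c |-> z f(c) - w c],
   with [f(c)] the integer nearest to [y (c + s) / q] and [y z - q w = 1]. *)

Require Import Defs.
From HB Require Import structures.
From mathcomp Require Import all_boot all_order all_algebra finmap.
From mathcomp Require Import all_classical all_reals all_analysis.
From mathcomp Require Import fintype finset ring lra zify.

Set Implicit Arguments.
Unset Strict Implicit.
Unset Printing Implicit Defensive.

Import Order.TTheory GRing.Theory Num.Theory.
Import numFieldNormedType.Exports.

Local Open Scope ring_scope.

(** * Sumsets in a finite abelian group *)

Section Combinatorics.
Variable G : finZmodType.
Implicit Types (A B C D X Z : {set G}) (a b c x z : G).

Definition ssum A B : {set G} := [set a + b | a in A, b in B].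

Lemma ssumP A B z :
  reflect (exists a b, [/\ a \in A, b \in B & z = a + b]) (z \in ssum A B).
Proof.
apply: (iffP imset2P) => [[a b aA bB ->]|[a [b [aA bB ->]]]].
  by exists a, b.
by exists a b.
Qed.

Lemma mem_ssum A B a b : a \in A -> b \in B -> a + b \in ssum A B.
Proof. exact: imset2_f. Qed.

Lemma ssumS A A' B B' : A \subset A' -> B \subset B' ->
  ssum A B \subset ssum A' B'.
Proof. exact: imset2S. Qed.

Lemma ssumA A B C : ssum A (ssum B C) = ssum (ssum A B) C.
Proof.
apply/setP => z; apply/ssumP/ssumP.
  move=> [a [_ [aA /ssumP [b [c [bB cC ->]]] ->]]].
  by exists (a + b), c; rewrite mem_ssum // addrA.
move=> [_ [c [/ssumP [a [b [aA bB ->]]] cC ->]]].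
by exists a, (b + c); rewrite mem_ssum // addrA.
Qed.

Lemma ssumC A B : ssum A B = ssum B A.
Proof.
apply/setP => z.
by apply/ssumP/ssumP => -[a [b [aA bB ->]]]; exists b, a; rewrite addrC.
Qed.

Lemma card_ssum_le A B : (#|ssum A B| <= #|A| * #|B|)%N.
Proof. by rewrite /ssum curry_imset2X -cardsX leq_imset_card. Qed.

Lemma ssum1r A c : ssum A [set c] = [set a + c | a in A].
Proof.
apply/setP => z; apply/ssumP/imsetP => [[a [b [aA /set1P -> ->]]]|[a aA ->]].
  by exists a.
by exists a, c; rewrite set11.
Qed.

Lemma card_ssum1r A c : #|ssum A [set c]| = #|A|.
Proof. by rewrite ssum1r card_imset //; apply: addIr. Qed.

Lemma ssumUr A B C : ssum A (B :|: C) = ssum A B :|: ssum A C.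
Proof.
apply/setP => z; rewrite inE; apply/ssumP/orP.
  by move=> [a [b [aA /setUP [bB|bC] ->]]]; [left|right]; apply: mem_ssum.
by case=> /ssumP [a [b [aA bB ->]]]; exists a, b; rewrite inE bB ?orbT.
Qed.

Lemma ssumUl A B C : ssum (B :|: C) A = ssum B A :|: ssum C A.
Proof. by rewrite ssumC ssumUr !(ssumC A). Qed.

(** Induction on [C], one element [c] at a time: both sides grow by controlled amounts, and
    minimality of the ratio at [X] compares the two losses, which come from the same subset [Z]. *)
Lemma petridis A X C :
  (forall Z, Z \subset X -> (#|ssum X A| * #|Z| <= #|ssum Z A| * #|X|)%N) ->
  (#|ssum (ssum X A) C| * #|X| <= #|ssum X A| * #|ssum X C|)%N.
Proof.
move=> minX.
have e0 (S : {set G}) : ssum S set0 = set0.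
  by apply/setP => z; rewrite inE; apply/ssumP => -[a [b [_]]]; rewrite inE.
have [m] := ubnP #|C|; elim: m C => // m IHm C; rewrite ltnS => leCm.
have {IHm leCm} : forall C' : {set G}, (#|C'| < #|C|)%N ->
    (#|ssum (ssum X A) C'| * #|X| <= #|ssum X A| * #|ssum X C'|)%N.
  by move=> C' lt; apply: IHm; apply: leq_trans lt leCm.
have [-> _|[c cC] IH] := set_0Vmem C; first by rewrite !e0 cards0.
set C1 := C :\ c.
have {IH} IH : (#|ssum (ssum X A) C1| * #|X| <= #|ssum X A| * #|ssum X C1|)%N.
  by apply: IH; rewrite (cardsD1 c C) cC.
have -> : C = C1 :|: [set c] by rewrite setUC setD1K.
rewrite !ssumUr.
(* For [x] in [Z] the translate [x + A + c] adds nothing new, so the left side gains at most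
   [|X + A| - |Z + A|]. If [x + c] already lies in [X + C1], then [x] is in [Z], so [X + C] gains at
   least [|X| - |Z|]. *)
pose Z := [set x in X | ssum (ssum [set x] A) [set c] \subset ssum (ssum X A) C1].
have ZX : Z \subset X by apply/subsetP => x; rewrite inE => /andP[].
have h1 : (#|ssum (ssum X A) C1 :|: ssum (ssum X A) [set c]| + #|ssum Z A| <=
    #|ssum (ssum X A) C1| + #|ssum X A|)%N.
  rewrite -(card_ssum1r (ssum X A) c) -(card_ssum1r (ssum Z A) c).
  rewrite -(cardsUI _ (ssum (ssum X A) [set c])) leq_add2l subset_leq_card //.
  apply/subsetP => z /ssumP [_ [c' [/ssumP [x [a [xZ aA ->]]] /set1P -> ->]]].
  rewrite inE; apply/andP; split; last first.
    by rewrite !mem_ssum ?set11 // (subsetP ZX).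
  move: xZ; rewrite inE => /andP[_ /subsetP]; apply.
  by rewrite !mem_ssum ?set11.
have h2 : (#|ssum X C1| + #|X| <= #|ssum X C1 :|: ssum X [set c]| + #|Z|)%N.
  rewrite -(card_ssum1r X c) -(card_ssum1r Z c) -cardsUI leq_add2l.
  apply: subset_leq_card.
  apply/subsetP => z /setIP [/ssumP [x' [c' [x'X c'C ->]]]].
  move=> /ssumP [x [_ [xX /set1P -> e]]]; rewrite e mem_ssum ?set11 //.
  rewrite inE xX; apply/subsetP => z'.
  move=> /ssumP [_ [_ [/ssumP [_ [a [/set1P -> aA ->]]] /set1P -> ->]]].
  by rewrite addrAC -e addrAC !mem_ssum.
have h3 := minX _ ZX.
set u1 := #|ssum (ssum X A) C1| in IH h1 *.
set u2 := #|ssum (ssum X A) C1 :|: _| in h1 *.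
set v1 := #|ssum X C1| in IH h2 *.
set v2 := #|ssum X C1 :|: _| in h2 *.
set s := #|ssum X A| in IH h1 h3 *; set r := #|ssum Z A| in h1 h3.
set xx := #|X| in IH h2 h3 *; set zz := #|Z| in h2 h3.
have := leq_mul h1 (leqnn xx); have := leq_mul (leqnn s) h2.
rewrite !mulnDl !mulnDr; lia.
Qed.

(** Minimality over all subsets of [A] serves twice: on subsets of [X] it is the hypothesis of
    [petridis], and at [Z = A] it bounds [|X + A| / |X|] by [|A + A| / |A|]. *)
Lemma min_ratio_subset A : A != set0 ->
  exists X, [/\ X \subset A, X != set0 &
    forall Z, Z \subset A -> (#|ssum X A| * #|Z| <= #|ssum Z A| * #|X|)%N].
Proof.
move=> A0.
pose P := [pred Z : {set G} | (Z \subset A) && (Z != set0)].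
pose r (Z : {set G}) : rat := #|ssum Z A|%:R / #|Z|%:R.
have PA : P A by rewrite /= subxx.
case: (Order.TotalTheory.arg_minP r PA) => X /= /andP [XA X0] minX.
exists X; split=> // Z ZA.
have [->|Z0] := eqVneq Z set0; first by rewrite cards0 muln0.
have := minX Z; rewrite ZA Z0 => /(_ isT).
rewrite /r ler_pdivlMr ?ltr0n ?card_gt0 // mulrAC ler_pdivrMr ?ltr0n ?card_gt0 //.
by rewrite -!natrM ler_nat.
Qed.

Definition sopp A : {set G} := [set - a | a in A].

Lemma mem_sopp A a : (- a \in sopp A) = (a \in A).
Proof. by rewrite /sopp mem_imset //; apply: oppr_inj. Qed.

(** Fix one representation [z = x1 - x2] of each difference. The map [(z, a) |-> (x1 + a, x2 + a)]
    is injective, since subtracting the coordinates recovers [z], hence [x1] and then [a]. *)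
Lemma ruzsa_triangle A X :
  (#|ssum X (sopp X)| * #|A| <= #|ssum X A| ^ 2)%N.
Proof.
pose h (z : G) : G * G :=
  odflt (0, 0) [pick p : G * G | [&& p.1 \in X, p.2 \in X & p.1 - p.2 == z]].
have hP z : z \in ssum X (sopp X) ->
    [/\ (h z).1 \in X, (h z).2 \in X & (h z).1 - (h z).2 = z].
  move=> /ssumP [a [_ [aX /imsetP [b bX ->] ->]]]; rewrite /h.
  case: pickP => [p /and3P [? ? /eqP ?] //|/(_ (a, b))].
  by rewrite /= aX bX eqxx.
pose F (p : G * G) := ((h p.1).1 + p.2, (h p.1).2 + p.2).
rewrite -cardsX -mulnn -cardsX -(@card_in_imset _ _ F).
  apply: subset_leq_card; apply/subsetP => _ /imsetP [[z a] /setXP [/= zD aA] ->].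
  have [h1 h2 _] := hP _ zD.
  by apply/setXP; split; apply: mem_ssum.
move=> [z a] [z' a'] /setXP [/= zD aA] /setXP [/= z'D a'A] [e1 e2].
have [_ _ hz] := hP _ zD; have [_ _ hz'] := hP _ z'D.
have ez : z = z'.
  have tr (p : G * G) b : p.1 - p.2 = (p.1 + b) - (p.2 + b).
    by rewrite opprD addrACA subrr addr0.
  by rewrite -hz -hz' (tr _ a) (tr _ a') e1 e2.
by move: e1; rewrite ez => /addrI ->.
Qed.

(* [X] is a maximal set chosen greedily so that each translate [x + A'] adds at
   least [#|A'| / 2] new elements. *)
Lemma covering A' (S : {set G}) : A' != set0 -> S != set0 ->
  exists X, [/\ X \subset S, X != set0,
     ((#|X| + 1) * #|A'| <= 2 * #|ssum S A'|)%N &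
     forall b, b \in S ->
       (#|A'| < 2 * #|[set a in A' | (b + a)%R \in ssum X A']|)%N].
Proof.
rewrite -card_gt0 => A0 /set0Pn [s0 s0S].
(* The [+ 1] records that the first translate contributes all of [A'], and each further one at least
   half of it. *)
pose P := [pred X : {set G} | [&& X \subset S, X != set0 &
   ((#|X| + 1) * #|A'| <= 2 * #|ssum X A'|)%N]].
have c1 b : #|ssum [set b] A'| = #|A'| by rewrite ssumC card_ssum1r.
have P0 : P [set s0].
  rewrite /= sub1set s0S cards1 c1 leqnn andbT.
  by apply/set0Pn; exists s0; rewrite set11.
case: (arg_maxnP (fun X : {set G} => #|X|) P0) => X /and3P [XS X0 cX] maxX.
exists X; split=> //.
  by apply: leq_trans cX _; rewrite leq_mul2l subset_leq_card ?ssumS.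
move=> b bS.
set T := [set a in A' | _].
have eT : #|ssum X A' :&: ssum [set b] A'| = #|T|.
  rewrite -(card_imset (mem T) (addrI b)); apply: eq_card => z.
  apply/setIP/imsetP.
    move=> [zX /ssumP [_ [a [/set1P -> aA e]]]]; exists a => //.
    by rewrite inE aA -e.
  move=> [a]; rewrite inE => /andP [aA baX] ->; split => //.
  by apply: mem_ssum; rewrite ?set11.
have := cardsUI (ssum X A') (ssum [set b] A'); rewrite -ssumUl eT c1.
set U := X :|: [set b] => eU.
have [bX|bX] := boolP (b \in X).
  have UX : U = X by apply/setUidPl; rewrite sub1set.
  move: eU A0; rewrite UX; lia.
have cU : #|U| = #|X|.+1 by rewrite /U setUC cardsU1 bX.
(* By maximality [U] violates the count: the translate by [b] adds fewer than [|A'| / 2] points, so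
   its overlap, of size [|T|], exceeds [|A'| / 2]. *)
have PU : ~~ P U.
  by apply/negP => /maxX; rewrite cU /= ltnn.
have US : U \subset S by rewrite subUset XS sub1set.
have U0 : U != set0 by apply/set0Pn; exists b; rewrite !inE eqxx orbT.
move: PU; rewrite /= US U0 /= cU -ltnNge => PU.
move: PU cX eU; rewrite addn1 !mulSn mulnDl mul1n !mul0n !addn0.
move: #|ssum U A'| #|ssum X A'| #|T| (#|X| * #|A'|)%N #|A'| => u v t xa s; lia.
Qed.

End Combinatorics.

(** * Boxes spanned by a list of generators *)

Section Boxes.
Variable G : finZmodType.
Implicit Types (g x z : G) (s : seq G).

(** Coefficients run from [-m] to [m]; indexing them by an ordinal bounds the size as that of an
    image. *)
Definition multiples (m : nat) g : {set G} :=
  [set g *~ (c%:Z - m%:Z) | c : 'I_(2 * m).+1].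

Lemma multiplesP m g z :
  reflect (exists2 c : int, (`|c| <= m)%N & z = g *~ c) (z \in multiples m g).
Proof.
apply: (iffP imsetP) => [[c _ ->]|[c hc ->]].
  exists (c%:Z - m%:Z) => //; have := ltn_ord c; lia.
have hc' : (`|(c + m%:Z)%R|%N < (2 * m).+1)%N by lia.
exists (Ordinal hc') => //=; congr (_ *~ _); lia.
Qed.

Fixpoint box (m : nat) s : {set G} :=
  if s is g :: s' then ssum (multiples m g) (box m s') else [set 0].

Lemma card_box m s : (#|box m s| <= (2 * m + 1) ^ size s)%N.
Proof.
elim: s => [|g s IH] /=; first by rewrite cards1.
rewrite expnS; apply: leq_trans (card_ssum_le _ _) _.
apply: leq_mul => //; apply: leq_trans (leq_imset_card _ _) _.
by rewrite card_ord addn1.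
Qed.

Lemma box_add m m' s x y :
  x \in box m s -> y \in box m' s -> x + y \in box (m + m') s.
Proof.
elim: s x y => [|g s IH] x y /=.
  by move=> /set1P -> /set1P ->; rewrite addr0 set11.
move=> /ssumP [_ [x' [/multiplesP [c hc ->] x's ->]]].
move=> /ssumP [_ [y' [/multiplesP [c' hc' ->] y's ->]]].
rewrite addrACA -mulrzDr; apply: mem_ssum; last exact: IH.
by apply/multiplesP; exists (c + c') => //; lia.
Qed.

Lemma box0 m s : 0 \in box m s.
Proof.
elim: s => [|g s IH] /=; first by rewrite set11.
by rewrite -[0]addr0 mem_ssum //; apply/multiplesP; exists 0; rewrite ?mulr0z.
Qed.

Lemma box1_mem s g : g \in s -> (g \in box 1 s) * (- g \in box 1 s).
Proof.
elim: s => [//|g' s IH]; rewrite inE => /orP [/eqP <-|/IH [h1 h2]] /=.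
  split; rewrite -[X in X \in _]addr0 mem_ssum ?box0 //; apply/multiplesP.
    by exists 1.
  by exists (-1); rewrite // mulrN1z.
split; rewrite -[X in X \in _]add0r mem_ssum //; apply/multiplesP;
by exists 0; rewrite ?mulr0z.
Qed.

Lemma box_sub m m' s : (m <= m')%N -> box m s \subset box m' s.
Proof.
move=> le; apply/subsetP => x xs; rewrite -(subnKC le) -[x]addr0.
by rewrite box_add ?box0.
Qed.

(** Both [B] and [B + t] lie in [B'], so inclusion-exclusion bounds their intersection from
    below. *)
Lemma large_overlap (B B' : {set G}) (t : G) :
  B \subset B' -> (forall b, b \in B -> b + t \in B') ->
  (2 * #|B| <= #|B'| + #|B :&: ssum B [set t]|)%N.
Proof.
move=> BB' BtB'; rewrite mul2n -addnn.
rewrite -[X in (_ + X <= _)%N](card_ssum1r B t) -cardsUI leq_add2r.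
apply: subset_leq_card; rewrite subUset BB'.
by apply/subsetP => _ /ssumP [b [_ [bB /set1P -> ->]]]; apply: BtB'.
Qed.

End Boxes.

(** * Polynomial against exponential growth *)

Lemma slow_growth (R : realFieldType) (u : nat -> nat) (c : R) (M : nat) :
  0 <= c -> (u M)%:R < (1 + c) ^+ M * (u 0)%:R ->
  exists2 m, (m < M)%N & (u m.+1)%:R <= (1 + c) * (u m)%:R.
Proof.
move=> c0; elim: M => [|M IH]; first by rewrite expr0 mul1r ltxx.
have [le _|lt h] := leP (u M.+1)%:R ((1 + c) * (u M)%:R); first by exists M.
have [|m mM hm] := IH; last by exists m => //; apply: ltnW.
rewrite -(ltr_pM2l (_ : 0 < 1 + c)); last by rewrite ltr_pwDl.
by apply: lt_trans lt _; rewrite mulrA -exprS.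
Qed.

Lemma bernoulli_ineq (R : realDomainType) (x : R) (n : nat) :
  0 <= x -> 1 + x *+ n <= (1 + x) ^+ n.
Proof.
move=> x0; elim: n => [|n IH]; first by rewrite mulr0n addr0.
rewrite exprS; apply: le_trans (_ : (1 + x) * (1 + x *+ n) <= _); last first.
  by rewrite ler_pM2l // ltr_pwDl.
rewrite mulrSr mulrDl mul1r mulrDr mulr1 addrA lerD2l lerDl.
by rewrite mulr_ge0 ?mulrn_wge0.
Qed.

(** The first bound makes a box with [r] generators of side [2M] have at most [(16h)^(6r)] points,
    and the second says that this is less than [M] growth steps by the factor [1 + kap] would
    produce. *)
Lemma growth_parameters (R : realType) (K h : R) (r : nat) :
  1 <= K -> 2 * K <= h -> (0 < r)%N -> r%:R + 1 <= 2 * K ^+ 2 ->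
  exists2 M : nat, (4 * M + 1)%:R <= (16 * h) ^+ 6 &
    (16 * h) ^+ (6 * r) < (1 + ((100 * h) ^+ 2)^-1) ^+ M.
Proof.
move=> K1 hK r0 cX.
set kap := (_ ^-1).
have h_ge2 : 2 <= h by apply: le_trans hK; rewrite ler_peMr.
have kap0 : 0 < kap by rewrite invr_gt0 exprn_gt0 //; lra.
have Q0 : 0 < 16 * h by lra.
(* By Bernoulli, [(1 + kap)^J] exceeds [16 h]; taking [6 r] such blocks gives [M]. *)
pose J := (Num.truncn (16 * h / kap)).+1.
pose M := (6 * r * J)%N.
have J1 : 16 * h <= kap * J%:R.
  rewrite [kap * _]mulrC -ler_pdivrMr //; apply: ltW; exact: truncnS_gt.
set Q := 16 * h in Q0 J1 *.
have Q32 : 32 <= Q by rewrite /Q; lra.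
have J2 : J%:R <= 50 * Q ^+ 3.
  have hQ : (100 * h) ^+ 2 <= (7 * Q) ^+ 2 by rewrite lerXn2r ?nnegrE /Q; lra.
  have : Q / kap <= Q * (7 * Q) ^+ 2 by rewrite /kap invrK ler_pM2l.
  have -> : Q * (7 * Q) ^+ 2 = 49 * Q ^+ 3 by ring.
  have : (Num.truncn (Q / kap))%:R <= Q / kap.
    by rewrite truncn_le divr_ge0 ?ltW.
  have : 1 <= Q ^+ 3 by rewrite exprn_ege1 //; lra.
  rewrite /J -natr1; lra.
have M1 : (4 * M + 1)%:R <= Q ^+ 6.
  (* Here [K <= h / 2 = Q / 32] and [r <= 2 K^2]. *)
  have r1 : r%:R <= Q ^+ 2 / 512.
    have : K ^+ 2 <= (Q / 32) ^+ 2 by rewrite lerXn2r ?nnegrE /Q; lra.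
    rewrite expr_div_n (_ : 32 ^+ 2 = 2 * 512 :> R); last by ring.
    by rewrite invfM mulrCA; lra.
  have : r%:R * J%:R <= Q ^+ 2 / 512 * (50 * Q ^+ 3) by apply: ler_pM.
  have -> : Q ^+ 2 / 512 * (50 * Q ^+ 3) = 50 / 512 * Q ^+ 5 by ring.
  have : 1 <= Q ^+ 5 by rewrite exprn_ege1 //; lra.
  have : 32 * Q ^+ 5 <= Q ^+ 6 by rewrite [in leRHS]exprS ler_pM2r ?exprn_gt0.
  have -> : (4 * M + 1)%:R = 24 * (r%:R * J%:R) + 1 :> R.
    by rewrite /M natrD !natrM; ring.
  lra.
have M2 : Q ^+ (6 * r) < (1 + kap) ^+ M.
  rewrite /M [X in _ < _ ^+ X]mulnC [ltRHS]exprM.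
  rewrite ltrXn2r ?muln_eq0 ?negb_or -?lt0n //; try lra.
  apply: lt_le_trans (_ : 1 + kap * J%:R <= _); first lra.
  by rewrite mulr_natr; apply: bernoulli_ineq; apply: ltW.
by exists M.
Qed.

(** * A set almost invariant under many translations *)

Section AlmostInvariant.
Variables (R : realType) (G : finZmodType).
Implicit Types (A B X : {set G}) (K h : R).

Lemma half_sets_meet (A S T : {set G}) : S \subset A -> T \subset A ->
  (#|A| < 2 * #|S|)%N -> (#|A| < 2 * #|T|)%N -> exists2 a, a \in S & a \in T.
Proof.
move=> SA TA hS hT.
have /set0Pn [a] : S :&: T != set0.
  rewrite -card_gt0.
  have : (#|S :|: T| <= #|A|)%N by rewrite subset_leq_card // subUset SA.
  have := cardsUI S T; lia.
by rewrite inE => /andP [aS aT]; exists a.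
Qed.

(** The two alternatives for [t] are the differences of [A'] and the shifts [x - x0] with [x] in
    [X]. The size bound on [B] later keeps its density below one half. *)
Lemma almost_invariant_set A K h :
  A != set0 -> 1 <= K -> 2 * K <= h -> #|ssum A A|%:R <= K * #|A|%:R ->
  exists A' X B x0,
    [/\ [/\ A' \subset A, A' != set0 & x0 \in X],
        #|X|%:R + 1 <= 2 * K ^+ 2,
        forall b, b \in ssum A A ->
          (#|A'| < 2 * #|[set a in A' | (b + a)%R \in ssum X A']|)%N,
        B != set0 /\ #|B|%:R <= K ^+ 2 * #|A|%:R * (16 * h) ^+ (6 * #|X|) &
        forall t, (t \in ssum A' (sopp A')) || (t + x0 \in X) ->
          (1 - ((100 * h) ^+ 2)^-1) * #|B|%:R <= #|B :&: ssum B [set t]|%:R].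
Proof.
move=> A0 K1 hK hAA.
have [A' [A'A A'0 minA']] := min_ratio_subset A0.
have cA : 0 < #|A|%:R :> R by rewrite ltr0n card_gt0.
have cA' : 0 < #|A'|%:R :> R by rewrite ltr0n card_gt0.
have K0 : 0 < K by apply: lt_le_trans K1.
have h1 : #|ssum A' A|%:R <= K * #|A'|%:R.
  have := minA' _ (subxx A); rewrite -(ler_nat R) !natrM => le.
  rewrite -(ler_pM2r cA); apply: le_trans le _.
  by rewrite mulrAC ler_pM2r.
have h2 : #|ssum (ssum A A) A'|%:R <= K ^+ 2 * #|A'|%:R.
  have pt := @petridis _ A A' A (fun Z ZA => minA' Z (subset_trans ZA A'A)).
  rewrite ssumC ssumA -(ler_pM2r cA').
  have -> : K ^+ 2 * #|A'|%:R * #|A'|%:R = (K * #|A'|%:R) * (K * #|A'|%:R) by ring.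
  move: pt; rewrite -(ler_nat R) !natrM => pt; apply: le_trans pt _.
  by apply: ler_pM.
have [x1 x1A] := set0Pn _ A0.
have [X [XAA X0 cX coverX]] : exists X, [/\ X \subset ssum A A, X != set0,
     ((#|X| + 1) * #|A'| <= 2 * #|ssum (ssum A A) A'|)%N &
     forall b, b \in ssum A A ->
       (#|A'| < 2 * #|[set a in A' | (b + a)%R \in ssum X A']|)%N].
  by apply: covering A'0 _; apply/set0Pn; exists (x1 + x1); apply: mem_ssum.
have {}cX : #|X|%:R + 1 <= 2 * K ^+ 2.
  rewrite -(ler_pM2r cA').
  move: cX; rewrite -(ler_nat R) !natrM natrD => cX; apply: le_trans cX _.
  by rewrite -mulrA ler_pM2l.
have [x0 x0X] := set0Pn _ X0.
set D := ssum A' (sopp A').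
have cD : #|D|%:R <= K ^+ 2 * #|A|%:R.
  have := ruzsa_triangle A A'; rewrite -(ler_nat R) natrM natrX -/D => le.
  rewrite -(ler_pM2r cA); apply: le_trans le _.
  apply: (@le_trans _ _ ((K * #|A'|%:R) ^+ 2)); first by rewrite lerXn2r ?nnegrE ?mulr_ge0 // ltW.
  rewrite -mulrA -expr2 exprMn ler_pM2l ?exprn_gt0 // lerXn2r ?nnegrE //.
  by rewrite ler_nat subset_leq_card.
pose s := [seq x - x0 | x <- enum X].
have sizes : size s = #|X| by rewrite size_map -cardE.
have ms x : x \in X -> x - x0 \in s.
  by move=> xX; apply/mapP; exists x => //; rewrite mem_enum.
(* For more than half of the [c] in [A'], [a1 + b1 + c] lies in [X + A'], and likewise for
   [a2 + b2 + c]. A common [c] exists, and it cancels in the difference. *)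
have DD a b : a \in D -> b \in D -> a + b \in ssum D (box 2 s).
  move=> /ssumP [a1 [_ [a1A /imsetP [a2 a2A ->] ->]]].
  move=> /ssumP [b1 [_ [b1A /imsetP [b2 b2A ->] ->]]].
  have S1 := coverX _ (mem_ssum (subsetP A'A _ a1A) (subsetP A'A _ b1A)).
  have S2 := coverX _ (mem_ssum (subsetP A'A _ a2A) (subsetP A'A _ b2A)).
  have [||c] := half_sets_meet _ _ S1 S2;
    try by apply/subsetP => z; rewrite inE => /andP [].
  rewrite !inE => /andP [_ /ssumP [u1 [v1 [u1X v1A e1]]]].
  move=> /andP [_ /ssumP [u2 [v2 [u2X v2A e2]]]].
  have -> : a1 - a2 + (b1 - b2) = (v1 - v2) + ((u1 - x0) + - (u2 - x0)).
    have -> : a1 - a2 + (b1 - b2) = (a1 + b1 + c) - (a2 + b2 + c).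
      rewrite [in RHS]opprD [RHS]addrACA subrr addr0 opprD; exact: addrACA.
    rewrite e1 e2 [u1 + v1]addrC [u2 + v2]addrC opprD addrACA; congr (_ + _).
    by rewrite opprB addrA addrNK.
  apply: mem_ssum; first by rewrite mem_ssum ?mem_sopp.
  by apply: (@box_add _ 1 1); rewrite ?(box1_mem (ms _ u1X)) ?(box1_mem (ms _ u2X)).
pose B m := ssum D (box (2 * m) s).
have D0 : 0 \in D.
  have [a aA] := set0Pn _ A'0.
  by rewrite -(subrr a) mem_ssum ?mem_sopp.
have BB m : B m \subset B m.+1
  by apply: ssumS; [exact: subxx|apply: box_sub; rewrite leq_mul2l leqnSn orbT].
(* A shift in [D] is absorbed by [DD] at the cost of 2 in the side of the box, a shift [x - x0] at
   the cost of 1; this is why [B m] uses side [2 * m]. *)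
have tB m t b : (t \in D) || (t + x0 \in X) -> b \in B m -> b + t \in B m.+1.
  move=> ht /ssumP [d [p [dD pP ->]]].
  case/orP: ht => ht.
    have /ssumP [d' [p' [d'D p'P e]]] := DD _ _ dD ht.
    rewrite addrAC e -addrA mem_ssum // mulnS; exact: box_add.
  rewrite -addrA mem_ssum // mulnS addnC.
  apply: box_add => //; apply: (subsetP (box_sub _ (leqnSn 1))).
  by have := ms _ ht; rewrite addrK => /box1_mem [].
have cB m : (#|B m| <= #|D| * (4 * m + 1) ^ #|X|)%N.
  apply: leq_trans (card_ssum_le _ _) _; rewrite leq_mul2l; apply/orP; right.
  by apply: leq_trans (card_box _ _) _; rewrite sizes mulnA.
have eB0 : (#|D| <= #|B 0|)%N.
  apply: subset_leq_card; apply/subsetP => d dD.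
  by rewrite -[d]addr0 mem_ssum ?box0.
set kap : R := ((100 * h) ^+ 2)^-1.
have h0 : 0 < h by apply: lt_le_trans hK; rewrite mulr_gt0.
have kap0 : 0 < kap by rewrite invr_gt0 exprn_gt0 // mulr_gt0.
have X1 : (0 < #|X|)%N by rewrite card_gt0.
have [M M1 M2] := growth_parameters K1 hK X1 cX.
set Q := 16 * h in M1 M2 *.
have Q0 : 0 < Q by rewrite mulr_gt0.
have BM m : (m <= M)%N -> #|B m|%:R <= #|D|%:R * Q ^+ (6 * #|X|).
  move=> mM; apply: (@le_trans _ _ (#|D| * (4 * m + 1) ^ #|X|)%:R).
    by rewrite ler_nat.
  rewrite natrM natrX exprM ler_wpM2l // lerXn2r ?nnegrE ?exprn_ge0 ?(ltW Q0) //.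
  by apply: le_trans M1; rewrite ler_nat leq_add2r leq_mul2l mM orbT.
have D1 : 0 < #|D|%:R :> R.
  by rewrite ltr0n card_gt0; apply/set0Pn; exists 0.
(* The sizes start at [|D|] or more and end below [(1 + kap)^M |D|], so some step grows by a factor
   at most [1 + kap]. *)
have [|m mM hm] := @slow_growth R (fun m => #|B m|) kap M (ltW kap0).
  apply: le_lt_trans (BM _ (leqnn M)) _; rewrite [ltRHS]mulrC.
  apply: (@lt_le_trans _ _ (#|D|%:R * (1 + kap) ^+ M)); first by rewrite ltr_pM2l.
  by rewrite ler_wpM2r ?ler_nat // exprn_ge0 // addr_ge0 // ltW.
exists A', X, (B m), x0; split=> //.
  split.
    by apply/set0Pn; exists (0 + 0); rewrite mem_ssum ?box0.
  apply: le_trans (BM _ (ltnW mM)) _.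
  by rewrite ler_wpM2r // exprn_ge0 // ltW.
move=> t ht.
have := large_overlap (BB m) (tB m t ^~ ht); rewrite -(ler_nat R) natrD natrM.
rewrite -/kap; lra.
Qed.
End AlmostInvariant.

(** * Cosine estimates and orthogonality modulo [q] *)

Section Trigonometry.
Variable R : realType.
Implicit Types (x u : R) (z w : int) (q : nat).

(** Up to [1 / 4] the mean value theorem applies, with [cos >= 1 / 2] and [pi >= 2]. Beyond, [sin]
    is increasing and already at least [1 / 2] at [pi / 4]. *)
Lemma sin_ge_linear u : 0 <= u <= 1 / 2 -> u <= sin (pi * u).
Proof.
move=> /andP [u0 u1].
have pi0 := pi_gt0 R.
have cos4 : 1 / 2 <= cos (pi / 4 : R) /\ 1 / 2 <= sin (pi / 4 : R).
  have s0 : 0 <= sin (pi / 4 : R) by apply: sin_ge0_pi; lra.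
  have e : sin (pi / 4) = cos (pi / 4) :> R.
    by rewrite -cosBpihalf -[RHS]cosN; congr cos; field.
  have := cos2Dsin2 (pi / 4 : R); rewrite e => e2.
  by split; rewrite -?e; nra.
have [le|gt] := leP u (1 / 4).
  have [->|u_neq0] := eqVneq u 0; first by rewrite mulr0 sin0.
  have x0 : 0 < pi * u by rewrite mulr_gt0 // lt_def u_neq0.
  have [|c /andP [c0 c1]] := @MVT R sin cos 0 (pi * u) x0
     (fun x _ => is_derive_sin x).
    by apply: continuous_subspaceT; move=> x; exact: continuous_sin.
  rewrite sin0 !subr0 => ->.
  move: c0 c1; rewrite !bnd_simp => c0 c1.
  have : 1 / 2 <= cos c.
    apply: le_trans cos4.1 (ltW _).
    by rewrite ltr_cos ?in_itv /=; nra.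
  have : 2 <= (pi : R) by exact: pi_ge2.
  nra.
have pu1 : pi * (1 / 4) < pi * u by rewrite ltr_pM2l.
have pu2 : pi * u <= pi * (1 / 2) by rewrite ler_pM2l.
apply: le_trans u1 _; apply: le_trans cos4.2 (ltW _).
by rewrite ltr_sin ?in_itv /=; lra.
Qed.

Lemma one_sub_cos_ge u : `|u| <= 1 / 2 -> 2 * u ^+ 2 <= 1 - cos (pi *+ 2 * u).
Proof.
wlog u0 : u / 0 <= u => [h|].
  have [/h//|/ltW u0] := leP 0 u.
  by rewrite -normrN -sqrrN -cosN -mulrN; apply: h; rewrite oppr_ge0.
rewrite ger0_norm // => u1.
have := @sin_ge_linear u; rewrite u0 u1 => /(_ isT) su.
have := cos2Dsin2 (pi * u).
rewrite [pi *+ 2 * u]mulrnAl cos_mulr2n => e.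
have : u ^+ 2 <= sin (pi * u) ^+ 2 by rewrite lerXn2r ?nnegrE // (le_trans u0).
lra.
Qed.

Lemma cos_periodicz x w : cos (x + pi *+ 2 * w%:~R) = cos x.
Proof.
have P n (y : R) : cos (y + pi *+ 2 * n%:R) = cos y.
  by rewrite mulr_natr (periodicn (@cosD2pi R)).
case: w => n; first exact: P.
by rewrite NegzE mulrNz mulrN -(P n.+1 (x - _)) addrNK.
Qed.

(** The real part of the additive character [z |-> e^(2 pi i z / q)]; the Fourier analysis below
    stays over the reals. *)
Definition zcos q z : R := cos (pi *+ 2 * (z%:~R / q%:R)).

Lemma zcos0 q : zcos q 0 = 1.
Proof. by rewrite /zcos mul0r mulr0 cos0. Qed.

Lemma zcosN q z : zcos q (- z) = zcos q z.
Proof. by rewrite /zcos mulrNz mulNr mulrN cosN. Qed.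

Lemma zcos_le1 q z : zcos q z <= 1.
Proof. exact: cos_le1. Qed.

Lemma zcosM q z w : zcos q z * zcos q w = (zcos q (z + w) + zcos q (z - w)) / 2.
Proof.
have lin (v : int) : pi *+ 2 * (v%:~R / q%:R) = v%:~R * (pi *+ 2 / q%:R) :> R.
  by rewrite mulrCA.
by rewrite /zcos !lin rmorphB rmorphD /= mulrBl [(_ + _) * (pi *+ 2 / _)]mulrDl
  cosD cosB; field.
Qed.

Lemma zcos_periodic q z w : (0 < q)%N -> zcos q (z + w * q%:Z) = zcos q z.
Proof.
move=> q0; have q0' : q%:R != 0 :> R by rewrite pnatr_eq0 -lt0n.
have e : (z + w * q%:Z)%:~R / q%:R = z%:~R / q%:R + w%:~R :> R.
  by rewrite rmorphD rmorphM /=; field.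
by rewrite /zcos e [_ * (_ + _)]mulrDr cos_periodicz.
Qed.

(** [one_sub_cos_ge] applied to the signed distance from [z / q] to its nearest integer. *)
Lemma zcos_near q z (d : R) : 0 <= d -> 1 - zcos q z <= 2 * d ^+ 2 ->
  exists f : int, `|z%:~R / q%:R - f%:~R| <= d.
Proof.
move=> d0 hz; set x := z%:~R / q%:R.
pose f := Num.floor (x + 1 / 2); exists f.
have /andP [f1 f2] := floor_itv (x + 1 / 2).
rewrite -/f rmorphD /= in f1 f2.
have u1 : `|x - f%:~R| <= 1 / 2 by rewrite ler_norml; apply/andP; split; lra.
have := one_sub_cos_ge u1.
have -> : cos (pi *+ 2 * (x - f%:~R)) = zcos q z.
  by rewrite -(cos_periodicz _ f) -mulrDr addrNK.
move=> h; rewrite -(ler_pXn2r (_ : 0 < 2)%N) ?nnegrE // real_normK ?num_real //.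
by lra.
Qed.

Lemma zcos_eq1 q z : (0 < q)%N -> zcos q z = 1 -> (q%:Z %| z)%Z.
Proof.
move=> q0 e; have [|f] := @zcos_near q z 0 (lexx _).
  by rewrite e subrr expr0n mulr0.
rewrite normr_le0 subr_eq0 => /eqP e2; apply/dvdzP; exists f.
apply/eqP; rewrite -(eqr_int R) rmorphM /= -e2 divfK ?pnatr_eq0 -?lt0n //.
Qed.

(** Orthogonality. Shifting [y] by one either way preserves the sum [S], so the product formula
    gives [S * zcos q z = S], and [zcos q z = 1] only if [q] divides [z]. *)
Lemma sum_zcos q z : (0 < q)%N ->
  \sum_(y < q) zcos q (y%:Z * z) = if (q%:Z %| z)%Z then q%:R else 0.
Proof.
move=> q0; case: ifPn => [/dvdzP [w ->]|ndvd].
  rewrite (eq_bigr (fun=> 1)) => [|y _]; last first.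
    by rewrite mulrA -[_ * q%:Z]add0r zcos_periodic // zcos0.
  by rewrite sumr_const card_ord.
set S := \sum_(y < q) _.
have shift (F : nat -> R) : F q = F 0%N ->
    \sum_(y < q) F y.+1 = \sum_(y < q) F y.
  move=> e; apply: (@addrI _ (F 0%N)); rewrite -[in RHS]e [RHS]addrC.
  by rewrite -(big_ord_recr q (fun y => F y)) big_ord_recl.
have S1 : \sum_(y < q) zcos q (y%:Z * z + z) = S.
  rewrite -[RHS](shift (fun y => zcos q (y%:Z * z))); last first.
    by rewrite mul0r mulrC -[_ * _]add0r zcos_periodic.
  by apply: eq_bigr => y _; rewrite intS mulrDl mul1r addrC.
have S2 : \sum_(y < q) zcos q (y%:Z * z - z) = S.
  rewrite -(shift (fun y => zcos q (y%:Z * z - z))); last first.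
    by rewrite mul0r sub0r mulrC addrC zcos_periodic.
  by apply: eq_bigr => y _; rewrite intS mulrDl mul1r addrAC subrr add0r.
have : S * (zcos q z - 1) = 0.
  rewrite mulrBr mulr1 mulr_suml.
  under eq_bigr do rewrite zcosM.
  by rewrite -mulr_suml big_split /= S1 S2; field.
move/eqP; rewrite mulf_eq0 => /orP [/eqP //|/eqP e].
case/negP: ndvd; apply: zcos_eq1 => //; lra.
Qed.

Lemma weighted_average_le (I : finType) (P : pred I) (p S : I -> R) (c : R) :
  (forall i, P i -> 0 <= p i) -> 0 < \sum_(i | P i) p i ->
  \sum_(i | P i) p i * S i <= c * \sum_(i | P i) p i ->
  exists2 i, P i & S i <= c.
Proof.
move=> p0 sp le; have [/existsP [i /andP [Pi Si]]|/existsPn no] :=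
  boolP [exists i, P i && (S i <= c)]; first by exists i.
suff : 0 < \sum_(i | P i) p i * (S i - c).
  under eq_bigr do rewrite mulrBr.
  by rewrite sumrB -mulr_suml [X in _ - X]mulrC; lra.
have gt i : P i -> c < S i by move=> Pi; have := no i; rewrite Pi /= ltNge.
have ge0 i : P i -> 0 <= p i * (S i - c).
  by move=> Pi; rewrite mulr_ge0 ?p0 // subr_ge0 ltW ?gt.
rewrite lt_def sumr_ge0 // andbT psumr_eq0 //; apply/negP => /allP h.
move: sp; rewrite big1 ?ltxx // => i Pi.
have := h i (mem_index_enum i); rewrite Pi mulf_eq0 subr_eq0 => /orP [/eqP //|].
by rewrite gt_eqF ?gt.
Qed.

End Trigonometry.

(** * Fourier analysis of a set modulo [q] *)

Section Fourier.
Variables (R : realType) (q' : nat).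
Local Notation q := q'.+1.
Implicit Types (x t : 'I_q) (B : {set 'I_q}).

Lemma ordD_modz x t : (q%:Z %| (x + t)%R%:Z - (x%:Z + t%:Z))%Z.
Proof.
apply/dvdzP; exists (- ((x + t) %/ q)%:Z).
rewrite /= -PoszD [in X in _ - X](divn_eq (x + t) q) PoszD PoszM; lia.
Qed.

Lemma dvdz_ord_eq x t : (q%:Z %| x%:Z - t%:Z)%Z = (x == t).
Proof.
apply/idP/eqP => [|->]; last by rewrite subrr dvdz0.
move=> /dvdzP [c e]; apply: val_inj => /=.
move: e (ltn_ord x) (ltn_ord t).
move: (nat_of_ord x) (nat_of_ord t) => {x t} x t e ltx ltt.
have [c0|[c0|c0]] : c = 0 \/ 1 <= c \/ c <= -1 by lia.
- by move: e; rewrite c0 mul0r; lia.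
- have : 1 * q%:Z <= c * q%:Z by rewrite ler_pM2r.
  by rewrite -e; lia.
have : c * q%:Z <= -1 * q%:Z by rewrite ler_pM2r.
by rewrite -e; lia.
Qed.

(** The squared modulus of the Fourier coefficient of the indicator of [B] at [y], expanded as a
    double sum. *)
Definition spectrum B (y : int) : R :=
  \sum_(b in B) \sum_(b' in B) zcos R q (y * (b%:Z - b'%:Z)).

Lemma spectrum0 B : spectrum B 0 = #|B|%:R ^+ 2.
Proof.
rewrite /spectrum; under eq_bigr do under eq_bigr do rewrite mul0r zcos0.
under eq_bigr do rewrite sumr_const.
by rewrite sumr_const expr2 mulr_natr.
Qed.

Lemma spectrum_ge0 B y : 0 <= spectrum B y.
Proof.
pose c (b : 'I_q) : R := cos ((y * b%:Z)%:~R * (pi *+ 2 / q%:R)).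
pose s (b : 'I_q) : R := sin ((y * b%:Z)%:~R * (pi *+ 2 / q%:R)).
have -> : spectrum B y = (\sum_(b in B) c b) ^+ 2 + (\sum_(b in B) s b) ^+ 2.
  rewrite !expr2 !mulr_suml -big_split; apply: eq_bigr => b _ /=.
  rewrite !mulr_sumr -big_split; apply: eq_bigr => b' _ /=.
  rewrite /zcos mulrBr mulrCA rmorphB /= [(_ - _) * (pi *+ 2 / _)]mulrBl.
  exact: cosB.
by rewrite addr_ge0 ?sqr_ge0.
Qed.

(** Fourier inversion for the autocorrelation of [B]: by orthogonality only pairs with [b = b' + t]
    survive. *)
Lemma sum_spectrum B t :
  \sum_(y < q) spectrum B y%:Z * zcos R q (y%:Z * t%:Z) =
  q%:R * #|B :&: ssum B [set t]|%:R.
Proof.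
pose N (b b' : 'I_q) : R := \sum_(y < q) zcos R q (y%:Z * (b%:Z - b'%:Z - t%:Z)).
have NE b b' : N b b' = q%:R * (b == b' + t)%:R.
  rewrite /N sum_zcos // -dvdz_ord_eq.
  have -> : (q%:Z %| b%:Z - b'%:Z - t%:Z)%Z = (q%:Z %| b%:Z - (b' + t)%R%:Z)%Z.
    have /dvdzP [c e] := ordD_modz b' t.
    have -> : b%:Z - (b' + t)%R%:Z = b%:Z - b'%:Z - t%:Z - c * q%:Z.
      by rewrite -e; lia.
    have d : (q%:Z %| c * q%:Z)%Z by rewrite dvdz_mull.
    apply/idP/idP => h; first exact: rpredB h d.
    by rewrite -[_ - t%:Z](subrK (c * q%:Z)); exact: rpredD h d.
  by case: ifP; rewrite ?mulr1 ?mulr0.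
have sumN : \sum_(b in B) \sum_(b' in B) N b b' =
    q%:R * #|B :&: ssum B [set t]|%:R.
  rewrite -sum1_card natr_sum mulr_sumr.
  rewrite (big_setID (ssum B [set t])) /= [X in _ + X]big1 ?addr0; last first.
    move=> b /setDP [bB bS]; apply: big1 => b' b'B; rewrite NE.
    case: eqP => [e|]; last by rewrite mulr0.
    by case/negP: bS; rewrite e mem_ssum ?set11.
  apply: eq_bigr => b /setIP [bB /ssumP [b1 [_ [b1B /set1P -> e]]]].
  rewrite (bigD1 b1) //= NE e eqxx big1 ?addr0 // => b' /andP [_ ne].
  by rewrite NE (inj_eq (addIr t)) eq_sym (negbTE ne) mulr0.
(* The cosine product formula yields both [b - b' - t] and [b - b' + t]; the latter becomes [N b' b]
   by evenness. *)
have -> : \sum_(y < q) spectrum B y%:Z * zcos R q (y%:Z * t%:Z) =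
    \sum_(b in B) \sum_(b' in B) (N b' b + N b b') / 2.
  under eq_bigr do rewrite mulr_suml.
  rewrite exchange_big; apply: eq_bigr => b _ /=.
  under eq_bigr do rewrite mulr_suml.
  rewrite exchange_big; apply: eq_bigr => b' _ /=.
  rewrite /N -big_split mulr_suml; apply: eq_bigr => y _ /=.
  rewrite zcosM -mulrDr -mulrBr; congr ((_ + _) / _).
  by rewrite -zcosN -mulrN; congr (zcos _ _ (_ * _)); lia.
under eq_bigr do rewrite -mulr_suml big_split /=.
by rewrite -mulr_suml big_split /= exchange_big /= sumN; field.
Qed.

(** Average the sum over [y] with weights [spectrum B y]. By inversion the total is at most
    [kap * q * |B|] times the total weight of [s]. The frequency 0 carries [|B|^2], at most half of
    [q * |B|], so the nonzero ones carry at least the other half; hence the factor 2. *)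
Lemma fourier_concentration B (kap : R) (s : seq (R * 'I_q)) :
  0 <= kap -> B != set0 -> (2 * #|B| <= q)%N ->
  (forall p, p \in s -> 0 <= p.1 /\
     (1 - kap) * #|B|%:R <= #|B :&: ssum B [set p.2]|%:R) ->
  exists2 y : 'I_q, y != 0 &
    \sum_(p <- s) p.1 * (1 - zcos R q (y%:Z * p.2%:Z)) <=
    2 * kap * \sum_(p <- s) p.1.
Proof.
move=> kap0 B0 Bq hs.
have b0 : 0 < #|B|%:R :> R by rewrite ltr0n card_gt0.
set W := \sum_(p <- s) p.1.
have W0 : 0 <= W.
  by rewrite /W big_seq sumr_ge0 // => p /hs [].
pose S (y : 'I_q) := \sum_(p <- s) p.1 * (1 - zcos R q (y%:Z * p.2%:Z)).
have tot : \sum_(y < q) spectrum B y%:Z = q%:R * #|B|%:R.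
  have := sum_spectrum B 0.
  under eq_bigr do rewrite /= mulr0 zcos0 mulr1.
  move=> ->; congr (_ * _%:R); congr #|pred_of_set _|.
  by rewrite ssum1r (eq_imset _ (@addr0 _)) imset_id setIid.
have split0 (F : 'I_q -> R) : \sum_(y < q) F y = F 0 + \sum_(y < q | y != 0) F y.
  by rewrite (bigD1 0).
have tot1 : \sum_(y < q | y != 0) spectrum B y%:Z = q%:R * #|B|%:R - #|B|%:R ^+ 2.
  by rewrite -tot split0 /= spectrum0; ring.
have Bq' : 2 * #|B|%:R <= q%:R :> R by rewrite -natrM ler_nat.
have half : q%:R * #|B|%:R / 2 <= \sum_(y < q | y != 0) spectrum B y%:Z.
  rewrite tot1 expr2.
  have : 2 * #|B|%:R * #|B|%:R <= q%:R * #|B|%:R :> R by rewrite ler_pM2r.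
  lra.
have S0 : \sum_(y < q | y != 0) spectrum B y%:Z * S y =
    \sum_(p <- s) p.1 * (q%:R * (#|B|%:R - #|B :&: ssum B [set p.2]|%:R)).
  transitivity (\sum_(y < q) spectrum B y%:Z * S y).
    rewrite split0 /= [X in _ * X]big1 ?mulr0 ?add0r // => p _.
    by rewrite mul0r zcos0 subrr mulr0.
  under eq_bigr do rewrite mulr_sumr.
  rewrite exchange_big; apply: eq_bigr => p _ /=.
  rewrite mulrBr -tot -sum_spectrum -sumrB mulr_sumr; apply: eq_bigr => y _.
  by rewrite mulrCA mulrBr mulr1.
have [||y y0 Sy] := @weighted_average_le R _ (fun y : 'I_q => y != 0)
    (fun y => spectrum B y%:Z) S (2 * kap * W) (fun y _ => spectrum_ge0 B y%:Z).
- by apply: lt_le_trans half; rewrite !mulr_gt0 ?invr_gt0.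
- apply: (@le_trans _ _ (kap * W * (q%:R * #|B|%:R))); last first.
    rewrite -[2 * _ * _]mulrA [2 * _]mulrC -[_ * 2 * _]mulrA.
    rewrite ler_wpM2l ?mulr_ge0 //; lra.
  rewrite S0 [kap * W]mulrC -mulrA /W mulr_suml big_seq [leRHS]big_seq.
  apply: ler_sum => p /hs [p0 hp]; apply: ler_wpM2l => //.
  rewrite mulrCA; apply: ler_wpM2l => //; lra.
by exists y.
Qed.

End Fourier.

(** * From average to pointwise concentration *)

Section Concentration.
Variables (R : realType) (q' : nat).
Local Notation q := q'.+1.
Implicit Types (A X Bad : {set 'I_q}) (K h rho : R) (y : 'I_q).

Definition gap (y t : 'I_q) : R := 1 - zcos R q (y%:Z * t%:Z).

Lemma gap_ge0 y t : 0 <= gap y t.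
Proof. by rewrite subr_ge0 zcos_le1. Qed.

(** Markov's inequality. *)
Lemma card_large_values (G : finType) (A : {set G}) (S : G -> R) (c e : R) :
  (forall a, 0 <= S a) ->
  \sum_(a in A) S a <= e -> c * #|[set a in A | c < S a]|%:R <= e.
Proof.
move=> S0; apply: le_trans; rewrite -sum1_card natr_sum mulr_sumr.
rewrite [leRHS](big_setID [set a in A | c < S a]) /= -[leLHS]addr0.
apply: lerD; last by rewrite sumr_ge0.
rewrite [leRHS](eq_bigl (mem [set a in A | c < S a])); last first.
  by move=> a; rewrite !inE andbA andbb.
by apply: ler_sum => a; rewrite inE mulr1 => /andP [_ /ltW].
Qed.

Lemma good_representation (G : finZmodType) (A' X Bad : {set G}) (b : G) :
  (2 * (#|X| + 1) * #|Bad| <= #|A'|)%N ->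
  (#|A'| < 2 * #|[set a in A' | (b + a)%R \in ssum X A']|)%N ->
  exists a a' x, [/\ a \in A' :\: Bad, a' \in A' :\: Bad, x \in X &
    b + a = x + a'].
Proof.
move=> hX hT; set T := [set a in A' | _] in hT.
(* The [a] to avoid are those in [Bad] and those equal to [x + a' - b] with [a'] in [Bad]: at most
   [(|X| + 1) |Bad|] in all, which is less than [|T|]. *)
have /subsetPn [a] : ~~ (T \subset Bad :|: ssum (ssum X Bad) [set - b]).
  apply/negP => /subset_leq_card le; move: (leq_trans le (leq_card_setU _ _)).
  rewrite card_ssum1r => {}le.
  have := leq_trans le (leq_add (leqnn _) (card_ssum_le X Bad)).
  move: hT hX; rewrite -mulnA mulnDl mul1n.
  move: #|A'| #|T| #|Bad| (#|X| * #|Bad|)%N => u1 u2 u3 u4; lia.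
rewrite inE => /andP [aA /ssumP [x [a' [xX a'A e]]]].
rewrite inE negb_or => /andP [aBad na]; exists a, a', x.
rewrite !inE aBad aA a'A xX e; split => //; rewrite andbT.
apply: contra na => a'Bad.
have -> : a = x + a' - b by rewrite -e addrC addKr.
by rewrite !mem_ssum ?set11.
Qed.

(** Each shifted element [c + s] is a combination of three differences at which [gap] is small, so
    an estimate on average over [A' - A'] and [X - x0] reaches every point of [A]. *)
Lemma concentration A K h : A != set0 -> 1 <= K -> 2 * K <= h ->
  #|ssum A A|%:R <= K * #|A|%:R ->
  (16 * h) `^ (12 * K ^+ 2) * #|A|%:R <= q%:R ->
  exists y s : 'I_q, y != 0 /\ forall c, c \in A ->
    exists f : int,
      `|(y%:Z * (c%:Z + s%:Z))%:~R / q%:R - f%:~R| <= 8 * K / (100 * h).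
Proof.
move=> A0 K1 hK hAA hq.
have [A' [X [B [x0 [[A'A A'0 x0X] cX cover [B0 cB] inv]]]]] :=
  almost_invariant_set A0 K1 hK hAA.
have K0 : 0 < K by apply: lt_le_trans K1.
have h0 : 0 < h by apply: lt_le_trans hK; rewrite mulr_gt0.
have K20 : 0 < 2 * K ^+ 2 by rewrite mulr_gt0 ?exprn_gt0.
set rho := (100 * h)^-1.
have rho0 : 0 < rho by rewrite invr_gt0 mulr_gt0.
rewrite -exprVn -/rho in inv.
(* The exponent [12 K^2] arises here: [2 K^2 <= (16h)^6], and [6 + 6 |X| <= 12 K^2]. *)
have Bq : (2 * #|B| <= q)%N.
  rewrite -(ler_nat R) natrM; apply: le_trans hq.
  set Q := 16 * h in cB *.
  have Q1 : 1 <= Q by rewrite /Q; lra.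
  apply: (@le_trans _ _ (Q ^+ 6 * #|A|%:R * Q ^+ (6 * #|X|))).
    apply: (@le_trans _ _ (2 * (K ^+ 2 * #|A|%:R * Q ^+ (6 * #|X|)))).
      by rewrite ler_pM2l.
    rewrite !mulrA ler_wpM2r ?exprn_ge0 ?ler_wpM2r //; first by rewrite (le_trans _ Q1).
    apply: (@le_trans _ _ (Q ^+ 2)); last by rewrite ler_weXn2l.
    have KQ : 2 * K <= Q by rewrite /Q; lra.
    have : (2 * K) ^+ 2 <= Q ^+ 2.
      by rewrite lerXn2r ?nnegrE // ?(le_trans ler01 Q1) // mulr_ge0 // ltW.
    rewrite exprMn; lra.
  rewrite mulrAC -exprD ler_wpM2r //.
  rewrite -(powR_mulrn (6 + 6 * #|X|)%N (le_trans ler01 Q1)).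
  rewrite ler_powR // natrD natrM; lra.
have a0' : 0 < #|A'|%:R :> R by rewrite ltr0n card_gt0.
(* The weights give total mass 1 to the differences of [A'] and at most 1 to the shifts [x - x0]. *)
pose al : R := (#|A'|%:R ^+ 2)^-1.
pose be : R := (2 * K ^+ 2)^-1.
have al0 : 0 < al by rewrite invr_gt0 exprn_gt0.
have be0 : 0 < be by rewrite invr_gt0.
pose s1 := [seq (al, a - a') | a <- enum A', a' <- enum A'].
pose s2 := [seq (be, x - x0) | x <- enum X].
have hs p : p \in s1 ++ s2 -> 0 <= p.1 /\
     (1 - rho ^+ 2) * #|B|%:R <= #|B :&: ssum B [set p.2]|%:R.
  rewrite mem_cat => /orP [/allpairsP [[a a'] /= []]|/mapP [x]].
    rewrite !mem_enum => aA a'A ->; split; first exact: ltW.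
    by apply: inv; rewrite mem_ssum ?mem_sopp.
  rewrite mem_enum => xX ->; split; first exact: ltW.
  by apply: inv; rewrite subrK xX orbT.
have sumE (F : R * 'I_q -> R) : \sum_(p <- s1 ++ s2) F p =
    \sum_(a in A') \sum_(a' in A') F (al, a - a') + \sum_(x in X) F (be, x - x0).
  rewrite big_cat big_allpairs_dep big_map !big_enum /=; congr (_ + _).
  by apply: eq_bigr => a _; rewrite big_enum.
have [y y0 hy0] := fourier_concentration (sqr_ge0 rho) B0 Bq hs.
have : \sum_(a in A') \sum_(a' in A') al * gap y (a - a') +
    \sum_(x in X) be * gap y (x - x0) <=
    2 * rho ^+ 2 * (\sum_(a in A') \sum_(a' in A') al + \sum_(x in X) be).
  by move: hy0; rewrite !sumE.
have -> : \sum_(a in A') \sum_(a' in A') al = 1.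
  under eq_bigr do rewrite sumr_const.
  by rewrite sumr_const -!mulrnA -mulr_natr natrM -expr2 mulVf // expf_neq0 // gt_eqF.
have W2 : 2 * rho ^+ 2 * (1 + \sum_(x in X) be) <= 4 * rho ^+ 2.
  have : \sum_(x in X) be <= 1.
    rewrite sumr_const -mulr_natr /be mulrC ler_pdivrMr //; lra.
  have := sqr_ge0 rho; nra.
move=> /le_trans /(_ W2) {W2}.
under eq_bigr do rewrite -mulr_sumr.
rewrite -!mulr_sumr => hy.
have S1 : 0 <= \sum_(a in A') \sum_(a' in A') gap y (a - a').
  by do 2!apply: sumr_ge0 => ? _; exact: gap_ge0.
have S2 : 0 <= \sum_(x in X) gap y (x - x0).
  by apply: sumr_ge0 => ? _; exact: gap_ge0.
have gX x : x \in X -> gap y (x - x0) <= 2 * (2 * K * rho) ^+ 2.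
  move=> xX; apply: (@le_trans _ _ (\sum_(x in X) gap y (x - x0))).
    rewrite [leRHS](bigD1 x) //= lerDl sumr_ge0 // => ? _; exact: gap_ge0.
  rewrite -(ler_pM2l be0); apply: (@le_trans _ _ (4 * rho ^+ 2)).
    by apply: le_trans hy; rewrite lerDr mulr_ge0 // ltW.
  rewrite le_eqVlt; apply/orP; left; apply/eqP.
  by rewrite /be; field; rewrite gt_eqF.
have [a0 a0A ha0] : exists2 a0, a0 \in A' &
    \sum_(a in A') gap y (a - a0) <= 4 * rho ^+ 2 * #|A'|%:R.
  apply: (@weighted_average_le R _ (mem A') (fun=> 1)) => //.
    by rewrite sumr_const.
  under eq_bigr do rewrite mul1r.
  rewrite exchange_big sumr_const /=.
  have : al * (\sum_(a in A') \sum_(a' in A') gap y (a - a')) <= 4 * rho ^+ 2.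
    by apply: le_trans hy; rewrite lerDl mulr_ge0 // ltW.
  by rewrite /al mulrC ler_pdivrMr ?exprn_gt0 // [#|A'|%:R ^+ 2]expr2 mulrA.
(* With this threshold Markov gives [|Bad| <= |A'| / (4 K^2)], as [good_representation] needs since
   [|X| + 1 <= 2 K^2]; and [c0] is below [2 (3 K rho)^2]. *)
pose c0 := 16 * K ^+ 2 * rho ^+ 2.
pose Bad := [set a in A' | c0 < gap y (a - a0)].
have cBad : (2 * (#|X| + 1) * #|Bad| <= #|A'|)%N.
  rewrite -(ler_nat R) !natrM natrD.
  have := card_large_values c0 (fun a => gap_ge0 y (a - a0)) ha0.
  rewrite -/Bad /c0 => hb.
  apply: (@le_trans _ _ (4 * K ^+ 2 * #|Bad|%:R)).
    rewrite ler_wpM2r //; lra.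
  rewrite -(ler_pM2l (_ : 0 < 4 * rho ^+ 2)) ?mulr_gt0 ?exprn_gt0 //.
  by apply: le_trans hb; rewrite le_eqVlt; apply/orP; left; apply/eqP; ring.
have good a : a \in A' :\: Bad -> gap y (a - a0) <= 2 * (3 * K * rho) ^+ 2.
  rewrite !inE => /andP [nb aA]; move: nb; rewrite aA /= -leNgt => le.
  apply: le_trans le _; rewrite /c0.
  have : 0 <= K ^+ 2 * rho ^+ 2 by rewrite mulr_ge0 ?sqr_ge0.
  rewrite !exprMn; lra.
have Kr : 0 <= K * rho by rewrite mulr_ge0 // ltW.
(* From [c + a0 + a = x + a'] one gets [c + (a0 - x0) = (x - x0) + (a' - a0) - (a - a0)], with
   errors [2 K rho + 3 K rho + 3 K rho]. *)
exists y, (a0 - x0); split => // c cA.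
have [a [a' [x [ga ga' xX e]]]] := good_representation cBad
  (cover _ (mem_ssum cA (subsetP A'A _ a0A))).
have d2 : 0 <= 2 * K * rho by rewrite -mulrA mulr_ge0.
have d3 : 0 <= 3 * K * rho by rewrite -mulrA mulr_ge0.
have [f1 hf1] := zcos_near d2 (gX _ xX).
have [f2 hf2] := zcos_near d3 (good _ ga').
have [f3 hf3] := zcos_near d3 (good _ ga).
have eG : c + (a0 - x0) + (a - a0) = (x - x0) + (a' - a0).
  by rewrite [c + (a0 - x0)]addrA [LHS]addrACA e [RHS]addrACA.
have /dvdzP [w1 hw1] := ordD_modz c (a0 - x0).
have /dvdzP [w2 hw2] := ordD_modz (c + (a0 - x0)) (a - a0).
have /dvdzP [w3 hw3] := ordD_modz (x - x0) (a' - a0).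
rewrite eG in hw2.
(* Lifted to the integers, the identity holds up to a multiple of [q], which changes [y t / q] by an
   integer only. *)
have eZ : c%:Z + (a0 - x0)%R%:Z = (x - x0)%R%:Z + (a' - a0)%R%:Z
    - (a - a0)%R%:Z + (w3 - w2 - w1) * q%:Z.
  rewrite !mulrBl -hw1 -hw2 -hw3; ring.
exists (f1 + f2 - f3 + y%:Z * (w3 - w2 - w1)).
rewrite eZ.
move: hf1 hf2 hf3.
set g := (x - x0)%R%:Z; set u := (a' - a0)%R%:Z; set v := (a - a0)%R%:Z.
set w := w3 - w2 - w1; set m := y%:Z => hf1 hf2 hf3.
have qn : q%:R != 0 :> R by rewrite pnatr_eq0.
have -> : (m * (g + u - v + w * q%:Z))%:~R / q%:R -
    (f1 + f2 - f3 + m * w)%:~R =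
    ((m * g)%:~R / q%:R - f1%:~R) + ((m * u)%:~R / q%:R - f2%:~R)
    - ((m * v)%:~R / q%:R - f3%:~R) :> R.
  rewrite !(rmorphD, rmorphB, rmorphM) /= -[(q%:Z)%:~R]/(q%:R).
  by move: (q%:R : R) qn => qr qn; field.
apply: le_trans (ler_normB _ _) _.
apply: le_trans (lerD (le_trans (ler_normD _ _) (lerD hf1 hf2)) hf3) _.
by rewrite le_eqVlt; apply/orP; left; apply/eqP; rewrite -/rho; ring.
Qed.

End Concentration.

(** * Rectification of a set with a concentrated dilate *)

Definition sum_faithful (k : nat) (A : {pred int}) (f : int -> int) : Prop :=
  forall a a' : 'I_k -> int,
    (forall i, a i \in A) -> (forall i, a' i \in A) ->
    (\sum_(i < k) a i = \sum_(i < k) a' i <->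
     \sum_(i < k) f (a i) = \sum_(i < k) f (a' i)).

Lemma bezout_window (y q : int) (m : int) : coprimez y q -> 1 <= q ->
  exists z w : int, [/\ y * z - q * w = 1, m < z & z <= m + q].
Proof.
move=> /coprimezP [[u v] /= e] q1.
have q0 : q != 0 by apply/eqP; lia.
have hd := divz_eq (u - m - 1) q.
have h1 := modz_ge0 (u - m - 1) q0.
have h2 : ((u - m - 1) %% q)%Z < q by rewrite ltz_pmod //; lia.
set t := ((u - m - 1) %/ q)%Z in hd; set r := modz _ _ in hd h1 h2.
exists (m + 1 + r), (- v - t * y); split; [|lia|lia].
have -> : m + 1 + r = u - t * q by lia.
by rewrite -e; ring.
Qed.

(* [z f(c) - w c] undoes the dilation [c |-> y c mod q]: multiplied by [q], it is
   [c - z (y c - q f(c))], in which [y c - q f(c)] is small. *)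
Lemma condense_integers (k N : nat) (y q s : int) (A : {pred int})
    (f : int -> int) :
  (2 <= k)%N -> (0 < N)%N -> 2 <= q -> q <= k%:Z * N%:Z + 1 -> coprimez y q ->
  {in A, forall c, 0 <= c <= N%:Z} ->
  {in A, forall c, 25 * k%:Z * `|y * (c + s) - q * f c| <= 2 * q} ->
  exists g : int -> int, sum_faithful k A g /\
    {in A &, forall c c', `|g c - g c'| < N%:Z}.
Proof.
move=> k2 N0 q2 qkN cop hA hf.
(* [z] must exceed every difference of two [k]-fold sums, and still be at most
   [k N + q <= 2 k N + 1]. *)
have [|z [w [e z1 z2]]] := @bezout_window y q (k%:Z * N%:Z) cop; first by lia.
pose E c := y * (c + s) - q * f c.
exists (fun c => z * f c - w * c); split.
  move=> a a' aA a'A.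
  have -> : \sum_(i < k) (z * f (a i) - w * a i) =
      z * (\sum_(i < k) f (a i)) - w * (\sum_(i < k) a i).
    by rewrite !mulr_sumr -sumrB.
  have -> : \sum_(i < k) (z * f (a' i) - w * a' i) =
      z * (\sum_(i < k) f (a' i)) - w * (\sum_(i < k) a' i).
    by rewrite !mulr_sumr -sumrB.
  have bE : 25 * `|\sum_(i < k) (E (a i) - E (a' i))| <= 4 * q.
    have k0 : 0 < k%:Z by lia.
    rewrite -(ler_pM2l k0) mulrCA -[X in X * (4 * q)](_ : \sum_(i < k) 1 = _).
      rewrite mulrA mulrC.
      apply: le_trans (_ : 25 * k%:Z * \sum_(i < k) `|E (a i) - E (a' i)| <= _).
        rewrite [leLHS]mulrC ler_wpM2l // ?ler_norm_sum //; lia.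
      rewrite mulr_sumr mulr_suml; apply: ler_sum => i _.
      have := hf _ (aA i); have := hf _ (a'A i).
      rewrite -/(E (a i)) -/(E (a' i)) => h1 h2.
      apply: le_trans (ler_wpM2l _ (ler_normB _ _)) _; first by lia.
      rewrite mulrDr; lia.
    by rewrite sumr_const card_ord natz.
  set F := \sum_(i < k) f (a i); set F' := \sum_(i < k) f (a' i).
  set S := \sum_(i < k) a i; set S' := \sum_(i < k) a' i.
  have eE : \sum_(i < k) (E (a i) - E (a' i)) = y * (S - S') - q * (F - F').
    rewrite /S /S' /F /F' -!sumrB !mulr_sumr -sumrB; apply: eq_bigr => i _.
    by rewrite /E; ring.
  rewrite eE in bE.
  have bS : `|S - S'| <= k%:Z * N%:Z.
    rewrite /S /S' -sumrB; apply: le_trans (ler_norm_sum _ _ _) _.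
    rewrite (_ : k%:Z * N%:Z = \sum_(i < k) N%:Z); last first.
      by rewrite sumr_const card_ord -mulr_natl natz.
    apply: ler_sum => i _; have := hA _ (aA i); have := hA _ (a'A i); lia.
  (* If [S = S'], then [q |F - F'|] is at most [4 q / 25], so [F = F']. Conversely, equal images
     make [S - S'] a multiple of [z], while [|S - S'| <= k N < z]. *)
  split=> [eS|eG].
    suff -> : F = F' by rewrite eS.
    move: bE; rewrite eS subrr mulr0 sub0r normrN normrM (gtr0_norm (_ : 0 < q)).
      move=> le; have [|] := leP 1 `|F - F'|; last by lia.
      rewrite -(ler_pM2l (_ : 0 < q)); lia.
    by lia.
  have eD : S - S' = z * (y * (S - S') - q * (F - F')).
    have eG' : z * (F - F') = w * (S - S') by rewrite !mulrBr; lia.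
    by rewrite mulrBr [z * (q * _)]mulrCA eG' -[LHS]mul1r -e; ring.
  set T := y * (S - S') - _ in eD.
  have [T0|T1] := eqVneq T 0; first by move: eD; rewrite T0 mulr0; lia.
  have : 1 <= `|T| by move: T1; lia.
  have z0 : 0 < z by lia.
  rewrite -(ler_pM2l z0) -{2}(gtr0_norm z0) -normrM -eD; lia.
move=> c c' cA c'A.
have h1 := hf _ cA; have h2 := hf _ c'A.
rewrite -/(E c) -/(E c') in h1 h2.
set G := _ - _.
have eG : q * G = (c - c') - z * (E c - E c').
  have -> : z * (E c - E c') = z * y * (c - c') - q * z * (f c - f c').
    by rewrite /E; ring.
  have -> : z * y = 1 + q * w by rewrite -e; ring.
  by rewrite /G; ring.
have bE : 25 * k%:Z * `|E c - E c'| <= 4 * q.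
  apply: le_trans (ler_wpM2l _ (ler_normB _ _)) _; first by lia.
  rewrite mulrDr; lia.
have kN : 2 <= k%:Z * N%:Z.
  by apply: le_trans (_ : 2 * 1 <= _) => //; apply: ler_pM => //; lia.
have bG : q * `|G| <= N%:Z + z * `|E c - E c'|.
  rewrite -{1}(gtr0_norm (_ : 0 < q)) -?normrM ?eG; last by lia.
  apply: le_trans (ler_normB _ _) _; apply: lerD.
    by have := hA _ cA; have := hA _ c'A; lia.
  by rewrite normrM gtr0_norm //; lia.
(* If [|G| >= N], then [25 k q N <= 25 k N + 4 z q]; with [2 z <= 5 k N] this forces [15 q <= 25],
   against [q >= 2]. *)
rewrite ltNge; apply/negP => NG.
have : 25 * k%:Z * (q * N%:Z) <= 25 * k%:Z * N%:Z + z * (4 * q).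
  apply: le_trans (_ : 25 * k%:Z * (N%:Z + z * `|E c - E c'|) <= _).
    apply: ler_wpM2l; first by lia.
    by apply: le_trans bG; apply: ler_wpM2l => //; lia.
  rewrite mulrDr lerD2l mulrCA; apply: ler_wpM2l => //; lia.
apply/negP; rewrite -ltNge.
have zq : 2 * (z * q) <= 5 * (k%:Z * N%:Z) * q by rewrite mulrA; apply: ler_wpM2r; lia.
have : 2 * (k%:Z * N%:Z) <= q * (k%:Z * N%:Z) by apply: ler_wpM2r; lia.
nia.
Qed.

(** * Formal properties of Freiman maps on the integers *)

Section FreimanMaps.
Implicit Types (A : {fset int}) (f g : int -> int).

(** Compare constant tuples; the integers are torsion-free. *)
Lemma sum_faithful_inj k A f : (0 < k)%N -> sum_faithful k (mem A) f ->
  {in A &, injective f}.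
Proof.
move=> k0 hf a b aA bA e.
have := (hf (fun=> a) (fun=> b) (fun=> aA) (fun=> bA)).2.
rewrite !sumr_const card_ord e => /(_ erefl) /eqP.
by rewrite -subr_eq0 -mulrnBl mulrn_eq0 eqn0Ngt k0 /= subr_eq0 => /eqP.
Qed.

Lemma sum_faithful_pair k A f a b c d : (2 <= k)%N -> sum_faithful k (mem A) f ->
  a \in A -> b \in A -> c \in A -> d \in A ->
  a + b = c + d -> f a + f b = f c + f d.
Proof.
case: k => [//|[//|k]] _ hf aA bA cA dA e.
(* Two-term sums are padded with copies of [a]. *)
pose t (u v : int) (i : 'I_k.+2) : int :=
  if i == ord0 then u else if i == lift ord0 ord0 then v else a.
have tA u v : u \in A -> v \in A -> forall i, t u v i \in A.
  by move=> uA vA i; rewrite /t; case: ifP => // _; case: ifP.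
have sE (F : int -> int) u v : \sum_(i < k.+2) F (t u v i) =
    F u + F v + \sum_(i < k) F a.
  by rewrite !big_ord_recl /= addrA.
have := (hf _ _ (tA _ _ aA bA) (tA _ _ cA dA)).1.
rewrite !(sE f) !(sE id) => h.
by apply: (addIr (\sum_(i < k) f a)); apply: h; rewrite e.
Qed.

(** [f] induces a well-defined map [phi] from [A + A] onto the sumset of the image, so the doubling
    hypothesis survives iteration. *)
Lemma card_sumset_image k A f : (2 <= k)%N -> sum_faithful k (mem A) f ->
  (#|` sumset [fset f a | a in A] [fset f a | a in A]|%fset <=
   #|` sumset A A|%fset)%N.
Proof.
move=> k2 hf.
have [phi hphi] : exists phi : int -> int, forall u a b, a \in A -> b \in A ->
    a + b = u -> f a + f b = phi u.
  suff /choice [phi hphi] : forall u, exists v, forall a b, a \in A -> b \in A ->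
    a + b = u -> f a + f b = v by exists phi.
  move=> u; have [[a [b [aA bA e]]]|no] :=
      pselect (exists a b, [/\ a \in A, b \in A & a + b = u]).
    exists (f a + f b) => a' b' a'A b'A e'.
    by apply: (sum_faithful_pair k2 hf) => //; rewrite e e'.
  by exists 0 => a b aA bA e; case: no; exists a, b.
rewrite -(size_map phi (sumset A A)); apply: uniq_leq_size; first exact: fset_uniq.
move=> _ /imfset2P [_ /imfsetP [a /= aA ->] [_ /imfsetP [b /= bA ->] ->]].
apply/mapP; exists (a + b); last exact: hphi.
by apply/imfset2P; exists a => //; exists b.
Qed.

Lemma sum_faithful_comp k A f g :
  sum_faithful k (mem A) f ->
  sum_faithful k (mem [fset f a | a in A]%fset) g ->
  sum_faithful k (mem A) (g \o f).
Proof.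
move=> hf hg a a' aA a'A; rewrite hf //.
have im (c : 'I_k -> int) : (forall i, c i \in A) ->
    forall i, f (c i) \in [fset f a | a in A]%fset.
  by move=> cA i; apply/imfsetP; exists (c i).
exact: (hg (f \o a) (f \o a') (im _ aA) (im _ a'A)).
Qed.

Lemma sum_faithful_shift k A f (m : int) :
  sum_faithful k (mem A) f -> sum_faithful k (mem A) (fun a => f a + m).
Proof.
move=> hf a a' aA a'A; rewrite hf // !big_split /=; split=> [-> //|].
exact: addIr.
Qed.

Lemma exists_min A f : A != fset0 ->
  exists2 a, a \in A & forall b, b \in A -> f a <= f b.
Proof.
move=> /fset0Pn [a0 a0A].
pose i0 : A := [` a0A]%fset.
case: (Order.TotalTheory.arg_minP (fun i : A => f (val i)) (isT : xpredT i0)).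
move=> i _ h; exists (val i); first exact: valP.
by move=> b bA; apply: (h [` bA]%fset).
Qed.

End FreimanMaps.

(** * Shrinking the diameter step by step *)

Lemma condense_step (R : realType) (K : R) (k N : nat) (A : {fset int}) :
  1 <= K -> (2 <= k)%N -> (0 < N)%N -> A != fset0 ->
  (forall a, a \in A -> 0 <= a <= N%:Z) ->
  (#|` sumset A A|%fset)%:R <= K * #|` A|%fset%:R ->
  (16 * k%:R * K) `^ (12 * K ^+ 2) * #|` A|%fset%:R <= N.+1%:R ->
  exists2 g : int -> int, sum_faithful k (mem A) g &
    forall a, a \in A -> 0 <= g a <= N.-1%:Z.
Proof.
move=> K1 k2 N0 A0 AN hAA hN.
suff [g hg gN] : exists2 g : int -> int, sum_faithful k (mem A) g &
    {in A &, forall c c', `|g c - g c'| < N%:Z}.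
  have [a1 a1A min1] := exists_min g A0.
  exists (fun a => g a - g a1); first exact: sum_faithful_shift.
  move=> a aA; have := min1 _ aA; have := gN _ _ aA a1A; lia.
(* Since [k >= 2], a sum of two elements of [A] is below [q] and does not wrap around. *)
set q' := (k * N)%N; set q := q'.+1.
pose Aq : {set 'I_q} := [set x : 'I_q | (x%:Z : int) \in A].
have natA a : a \in A -> exists2 x : 'I_q, x \in Aq & x%:Z = a.
  move=> aA; have /andP [h1 h2] := AN _ aA.
  have lt : (`|a|%N < q)%N.
    rewrite ltnS /q'; apply: leq_trans (leq_pmull N (ltnW k2)); lia.
  exists (Ordinal lt); last by rewrite /=; lia.
  by rewrite inE /= (_ : Posz `|a| = a) //; lia.
have ordZ_inj : injective (fun x : 'I_q => x%:Z).
  by move=> x1 x2 /= [] /val_inj.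
have cAq : #|Aq| = #|` A|%fset.
  rewrite cardE -(size_map (fun x : 'I_q => x%:Z)); apply: perm_size.
  apply: uniq_perm; rewrite ?map_inj_uniq ?enum_uniq ?fset_uniq // => a.
  apply/mapP/idP => [[x]|/natA [x xA <-]]; first by rewrite mem_enum inE => ? ->.
  by exists x; rewrite ?mem_enum.
have cAAq : (#|ssum Aq Aq| <= #|` sumset A A|%fset)%N.
  rewrite cardE -(size_map (fun x : 'I_q => x%:Z)); apply: uniq_leq_size.
    by rewrite map_inj_uniq ?enum_uniq.
  move=> z /mapP [x]; rewrite mem_enum => /ssumP [a [b [aA bA ->]]] ->.
  move: aA bA; rewrite !inE => aA bA.
  apply/imfset2P; exists a%:Z => //; exists b%:Z => //=.
  rewrite modn_small // ltnS.
  have /andP [_ aN] := AN _ aA; have /andP [_ bN] := AN _ bA.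
  apply: (@leq_trans (2 * N)%N); last by rewrite leq_mul2r k2 orbT.
  by rewrite mul2n -addnn leq_add.
have k0 : 0 < k%:R :> R by rewrite ltr0n; lia.
have Aq0 : Aq != set0.
  by have /fset0Pn [a /natA [x xA _]] := A0; apply/set0Pn; exists x.
(* Taking [h = k K] makes the error [8 K / (100 h) = 2 / (25 k)]. *)
have [y [s [y0 hys]]] : exists y s : 'I_q, y != 0 /\ forall c, c \in Aq ->
    exists f : int,
      `|(y%:Z * (c%:Z + s%:Z))%:~R / q%:R - f%:~R| <= 8 * K / (100 * (k%:R * K)).
  apply: concentration => //.
  - by rewrite ler_wpM2r ?ler_nat // (le_trans ler01).
  - by rewrite cAq; apply: le_trans hAA; rewrite ler_nat.
  rewrite cAq mulrA; apply: le_trans hN _.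
  by rewrite ler_nat ltnS leq_pmull // ltnW.
have [f hf] : exists f : int -> int, forall c : int, c \in A ->
    25 * k%:Z * `|y%:Z * (c + s%:Z) - q%:Z * f c| <= 2 * q%:Z.
  suff /choice [f hf] : forall c : int, exists v : int, c \in A ->
    25 * k%:Z * `|y%:Z * (c + s%:Z) - q%:Z * v| <= 2 * q%:Z by exists f.
  move=> c; have [cA|] := boolP (c \in A); last by exists 0.
  have [x xA <-] := natA _ cA; have [v hv] := hys _ xA.
  exists v => _; rewrite -(ler_int R) !rmorphM /= intr_norm rmorphB /=.
  rewrite [(q%:Z * v)%:~R]rmorphM /=.
  set u : R := (y%:Z * _)%:~R in hv *.
  have q0 : 0 < q%:R :> R by rewrite ltr0n.
  have e : u - q%:R * v%:~R = (u / q%:R - v%:~R) * q%:R.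
    by rewrite mulrBl divfK ?gt_eqF // [v%:~R * _]mulrC.
  rewrite -[(q%:Z)%:~R]/(q%:R) -[(k%:Z)%:~R]/(k%:R) e normrM (gtr0_norm q0).
  rewrite mulrA ler_pM2r // mulrC -ler_pdivlMr; last by rewrite mulr_gt0.
  apply: le_trans hv _; rewrite le_eqVlt; apply/orP; left; apply/eqP.
  by field; rewrite !gt_eqF // (lt_le_trans ltr01).
(* [y] and [q] need not be coprime; dividing both by [d] preserves the homogeneous error bound, and
   [q / d >= 2] because [d <= y < q]. *)
set d := gcdn y q.
have y_gt0 : (0 < y)%N by rewrite lt0n; apply: contra y0 => /eqP e; apply/eqP/val_inj.
have d0 : (0 < d)%N by rewrite gcdn_gt0 orbT.
have dy : (d %| y)%N by apply: dvdn_gcdl.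
have dq : (d %| q)%N by apply: dvdn_gcdr.
set y1 := (y %/ d)%N; set q1 := (q %/ d)%N.
have ey : y = (y1 * d)%N :> nat by rewrite divnK.
have eq1 : q = (q1 * d)%N by rewrite divnK.
have [g [hg gN]] : exists g : int -> int, sum_faithful k (mem A) g /\
    {in mem A &, forall c c', `|g c - g c'| < N%:Z}.
  apply: (@condense_integers k N y1%:Z q1%:Z s%:Z (mem A) f) => //.
  - have : (d < q)%N by apply: leq_ltn_trans (ltn_ord y); apply: dvdn_leq.
    rewrite eq1; have [|] := leqP 2 q1; first by lia.
    case: q1 {eq1} => [|[|//]] _; rewrite ?mul0n ?mul1n ?ltnn //.
  - by rewrite -PoszM -(PoszD _ 1) lez_nat addn1; apply: leq_div.
  - by rewrite coprimezE /= /coprime /y1 /q1 -(eqn_pmul2r d0) muln_gcdl !divnK // mul1n.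
  move=> c cA; have := hf c cA.
  have -> : y%:Z = y1%:Z * d%:Z by rewrite -PoszM -ey.
  have -> : q%:Z = q1%:Z * d%:Z by rewrite -PoszM -eq1.
  have -> : y1%:Z * d%:Z * (c + s) - q1%:Z * d%:Z * f c =
     (y1%:Z * (c + s) - q1%:Z * f c) * d%:Z by ring.
  by rewrite normrM (gtr0_norm (d0 : 0 < d%:Z)) !mulrA ler_pM2r.
by exists g.
Qed.

(** Induction on [N], composing with [condense_step] on the image of [f] while the interval is too
    long. The bound is on [g a + 1] because the last translation moves 0 to 1. *)
Lemma condense_all (R : realType) (K : R) (k N : nat) (A : {fset int})
    (f : int -> int) :
  1 <= K -> (2 <= k)%N -> A != fset0 ->
  (#|` sumset A A|%fset)%:R <= K * #|` A|%fset%:R ->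
  sum_faithful k (mem A) f -> (forall a, a \in A -> 0 <= f a <= N%:Z) ->
  exists2 g : int -> int, sum_faithful k (mem A) g &
    forall a, a \in A -> 0 <= g a /\
      (g a + 1)%:~R <= (16 * k%:R * K) `^ (12 * K ^+ 2) * #|` A|%fset%:R.
Proof.
move=> K1 k2 A0 hAA; set L := _ `^ _.
elim: N f => [|N IH] f hf fN.
  have L1 : 1 <= L.
    have kK : 2 * 1 <= k%:R * K by apply: ler_pM; rewrite ?ler_nat.
    rewrite -(powRr0 (16 * k%:R * K)); apply: ler_powR; first lra.
    by rewrite mulr_ge0 ?sqr_ge0.
  exists f => // a aA; have := fN _ aA => /le_anti <-; split=> //.
  rewrite add0r -[1%:~R]mulr1; apply: ler_pM => //.
  by rewrite (ler_nat _ 1) cardfs_gt0.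
have [le|gt] := leP N.+2%:R (L * #|` A|%fset%:R).
  exists f => // a aA; have /andP [f0 fN1] := fN _ aA; split=> //.
  apply: le_trans le; rewrite -[N.+2%:R]/((N.+2%:Z)%:~R) ler_int; lia.
have k0 := ltnW k2.
pose fA := [fset f a | a in A]%fset.
have cfA : #|` fA|%fset = #|` A|%fset.
  by apply: card_in_imfset; apply: (sum_faithful_inj k0 hf).
have [||||g hg gN] := @condense_step R K k N.+1 fA K1 k2 isT.
- by rewrite -cardfs_gt0 cfA cardfs_gt0.
- by move=> _ /imfsetP [a /= aA ->]; apply: fN.
- rewrite cfA; apply: le_trans hAA.
  by rewrite ler_nat; apply: card_sumset_image k2 hf.
- by rewrite cfA ltW.
apply: (IH (g \o f)); first exact: sum_faithful_comp hf hg.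
by move=> a aA; apply: gN; apply/imfsetP; exists a.
Qed.

Theorem theorem3 (R : realType) (K : R) (k : nat) (A : {fset int}) (n : nat)
    (hK : 1 <= K) (hk : (2 <= k)%N) (hn : #|` A|%fset = n)
    (hAA : (#|` sumset A A|%fset)%:R = K * n%:R) :
  exists2 B : {fset int}, Freiman_isomorphic k (mem A) (mem B) &
    forall b : int, b \in B ->
      1 <= b /\ b%:~R <= ((16 * k%:R * K) `^ (12 * K ^+ 2)) * n%:R.
Proof.
suff [g hg gL] : exists2 g : int -> int, sum_faithful k (mem A) g &
    forall a, a \in A -> 1 <= g a /\
      (g a)%:~R <= (16 * k%:R * K) `^ (12 * K ^+ 2) * n%:R.
  exists [fset g a | a in A]%fset.
    exists g; last by move=> b /imfsetP [a /= aA ->]; exists a.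
    split=> // [a aA|]; first by apply/imfsetP; exists a.
    exact: sum_faithful_inj (ltnW hk) hg.
  by move=> _ /imfsetP [a /= aA ->]; apply: gL.
(* The empty set has no minimum to translate to 0. *)
have [->|A0] := eqVneq A fset0.
  by exists id => // a; rewrite inE.
have [a1 a1A min1] := exists_min id A0.
have [a2 a2A max2] := exists_min -%R A0.
have [|||g hg gL] := @condense_all R K k `|a2 - a1|%N A (fun a => a - a1) hK hk A0.
- by rewrite hAA hn.
- exact: (@sum_faithful_shift k A id (- a1)).
- move=> a aA; have := min1 _ aA; have := max2 _ aA; rewrite /=; lia.
exists (fun a => g a + 1); first exact: sum_faithful_shift.
by rewrite -hn => a aA; have [g0 gL'] := gL _ aA; split=> //; lia.
Qed.
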